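(* Let $k\ge 4$ be an even integer and let $\mathrm{CHICHI}_{2k}\colon\mathbb{F}_2^{2k}\to\mathbb{F}_2^{2k}$, $x=(x_0,\dots,x_{2k-1})\mapsto y=(y_0,\dots,y_{2k-1})$, be defined by $$y_i=\begin{cases} x_i+\bar{x}_{i+1}x_{i+2}, & i<k-3 \text{ or } k<i<2k-2,\\ x_k+\bar{x}_{k-2}x_0, & i=k-3,\\ x_{k-1}+\bar{x}_0x_1, & i=k-2,\\ \bar{x}_{k-3}+\bar{x}_k\bar{x}_{k+1}, & i=k-1,\\ x_{k-2}+\bar{x}_{k+1}x_{k+2}, & i=k,\\ x_{2k-2}+\bar{x}_{2k-1}x_{k-1}, & i=2k-2,\\ x_{2k-1}+\bar{x}_{k-1}x_k, & i=2k-1,\end{cases}$$ where $\bar{x}_j=x_j+1$. Then every non-trivial component of the inverse of $\mathrm{CHICHI}_{2k}$ has algebraic degree $k$.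
   Context: $\mathrm{CHICHI}_{2k}$ is a permutation of $\mathbb{F}_2^{2k}$. A non-trivial component of a map $G\colon\mathbb{F}_2^{2k}\to\mathbb{F}_2^{2k}$ is a Boolean function $x\mapsto b\cdot G(x)$ with $b\in\mathbb{F}_2^{2k}\setminus\{0\}$, where $\cdot$ is the standard inner product; the algebraic degree of a Boolean function is the degree of its algebraic normal form. *)

(* Defs.v *)
From mathcomp Require Import all_boot.
Set Implicit Arguments. Unset Strict Implicit. Unset Printing Implicit Defensive.

(* Vectors of F_2^n are represented as {ffun 'I_n -> bool}; F_2 addition is xorb,
   multiplication is &&, and xbar_j = x_j + 1 is ~~ x_j. *)
Notation vec n := {ffun 'I_n -> bool}.

(* Coordinate access by a natural-number index (only used with in-range indices). *)
Definition coord n (x : vec n) (j : nat) : bool :=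
  match (insub j : option 'I_n) with Some i => x i | None => false end.

Definition CHICHI (k : nat) (x : vec (2 * k)) : vec (2 * k) :=
  [ffun i : 'I_(2 * k) =>
    let X := coord x in
    let i := val i in
    if i == k - 3 then xorb (X k) (~~ X (k - 2) && X 0)
    else if i == k - 2 then xorb (X (k - 1)) (~~ X 0 && X 1)
    else if i == k - 1 then xorb (~~ X (k - 3)) (~~ X k && ~~ X (k + 1))
    else if i == k then xorb (X (k - 2)) (~~ X (k + 1) && X (k + 2))
    else if i == 2 * k - 2 then xorb (X (2 * k - 2)) (~~ X (2 * k - 1) && X (k - 1))
    else if i == 2 * k - 1 then xorb (X (2 * k - 1)) (~~ X (k - 1) && X k)
    else (* i < k-3 or k < i < 2k-2 *) xorb (X i) (~~ X i.+1 && X i.+2)].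

Definition dot n (b y : vec n) : bool := \big[xorb/false]_(i < n) (b i && y i).

(* Coefficient of the monomial prod_{i in u} x_i in the algebraic normal form
   of f (Moebius transform): a_u = sum_{x <= u} f(x) over F_2. *)
Definition anf_coef n (f : vec n -> bool) (u : vec n) : bool :=
  \big[xorb/false]_(x : vec n | [forall i, x i ==> u i]) f x.

(* Algebraic degree: largest Hamming weight of a monomial with nonzero ANF coefficient
   (0 for the zero function). *)
Definition alg_degree n (f : vec n -> bool) : nat :=
  \max_(u : vec n | anf_coef f u) #|[set i | u i]|.

(* Main.v *)
(* The coefficient of the monomial u in b . G^-1 is the sum of b . x over the x with
   G_i(x) = 0 for all i outside u, i.e. the coefficient of the full monomial in
   (b . x) * prod_(i in S) (1 + G_i(x)) with S the complement of u. As G is quadratic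
   this vanishes for |S| < k, so the degree is at most k.

   The quadratic monomials of G_i are the edges of two disjoint odd cycles, of lengths
   k - 1 and k + 1, while the linear terms are permuted by a p that links the two
   cycles. For |S| = k take S = M + {e}, where the edges of M match all vertices but
   one in each cycle, q and p(e). The vertex p(e) can only be covered by the linear
   term of G_e, and a count then forces every i in M to contribute its edge: the
   coefficient for b is b_q + t b_(p(e)). The vertices q for which such an S exists
   are arranged so that, starting from one with t = 0, all b_q vanish if the degree
   is less than k. *)
Require Import Defs.
From mathcomp Require Import all_boot.
From mathcomp Require Import zify.

Set Implicit Arguments. Unset Strict Implicit. Unset Printing Implicit Defensive.

(** * Sums over the vectors modulo 2 *)

Lemma big_xorb (I : Type) (r : seq I) (P : pred I) (F : I -> bool) :
  \big[xorb/false]_(i <- r | P i) F i = \big[addb/false]_(i <- r | P i) F i.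
Proof. by apply: (big_rec2 eq) => // i y1 y2 _ ->; case: (F i); case: y2. Qed.

Definition flip n (u : 'I_n) (x : vec n) : vec n := [ffun i => x i (+) (i == u)].

Lemma flipK n (u : 'I_n) : involutive (flip u).
Proof. by move=> x; apply/ffunP => i; rewrite !ffunE addbK. Qed.

(** The vectors pair off under [flip u], and the two equal values of each pair cancel modulo 2. *)
Lemma sum_flip_invariant n (u : 'I_n) (f : vec n -> bool) :
  (forall x, f (flip u x) = f x) -> \big[addb/false]_x f x = false.
Proof.
move=> fE; rewrite (bigID (fun x : vec n => x u)) /=.
rewrite [X in _ (+) X](reindex_inj (inv_inj (flipK u))) /=.
under [X in _ (+) X]eq_bigl => x do rewrite ffunE eqxx addbT negbK.
under [X in _ (+) X]eq_bigr => x _ do rewrite fE.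
exact: addbb.
Qed.

(** * Solutions of a quadratic system, counted modulo 2 *)

Section QuadraticSystem.

(* The [i]-th equation of the system reads [term i false x + term i true x = 1],
   with an affine first term and a product of two affine forms as second. *)
Variables (n : nat) (p v w : 'I_n -> 'I_n) (sp sw : 'I_n -> bool).

Implicit Types (S : {set 'I_n}) (phi : {ffun 'I_n -> bool}).

Definition term (i : 'I_n) (c : bool) (x : vec n) : bool :=
  if c then ~~ x (v i) && (x (w i) (+) sw i) else x (p i) (+) sp i.

Definition dep (i : 'I_n) (c : bool) : {set 'I_n} :=
  if c then [set v i; w i] else [set p i].

Definition solution_parity S (j : 'I_n) : bool :=
  \big[addb/false]_(x : vec n)
    (x j && \big[andb/true]_(i in S) (term i true x (+) term i false x)).

Definition choice_parity S (j : 'I_n) phi :=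
  \big[addb/false]_(x : vec n)
    (x j && \big[andb/true]_(i in S) term i (phi i) x).

(** Distributivity: [phi] records which of its two terms each equation of [S] contributes. *)
Lemma solution_parityE S j :
  solution_parity S j =
  \big[addb/false]_(phi in pffun_on false (mem S) predT)
    choice_parity S j phi.
Proof.
rewrite exchange_big; apply: eq_bigr => x _ /=; rewrite -big_distrr /=.
congr (_ && _).
rewrite -(big_distr_big false (mem S) predT (fun i c => term i c x)) /=.
by apply: eq_bigr => i _; rewrite big_bool.
Qed.

Lemma term_flip u i c x : u \notin dep i c -> term i c (flip u x) = term i c x.
Proof.
rewrite /dep /term; case: c; rewrite !inE.
  by rewrite negb_or !ffunE ![_ == u]eq_sym => /andP[/negPf-> /negPf->]; rewrite !addbF.
by rewrite !ffunE [_ == u]eq_sym => /negPf->; rewrite addbF.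
Qed.

Lemma choice_parity_uncovered S j phi u :
  u != j -> (forall i, i \in S -> u \notin dep i (phi i)) ->
  choice_parity S j phi = false.
Proof.
move=> uj udep; apply: (@sum_flip_invariant _ u) => x.
rewrite ffunE eq_sym (negPf uj) addbF; congr (_ && _).
by apply: eq_bigr => i iS; rewrite term_flip ?udep.
Qed.

Lemma choice_parity_cover S j phi :
  choice_parity S j phi ->
  forall u, u != j -> exists2 i, i \in S & u \in dep i (phi i).
Proof.
move=> chi u uj; apply/exists_inP; apply: contraT; rewrite negb_exists_in.
by move=> /forall_inP udep; move: chi; rewrite (choice_parity_uncovered uj).
Qed.

Lemma card_dep i c : #|dep i c| <= c.+1.
Proof. by case: c; rewrite /dep ?cards2 ?cards1 //; case: eqP. Qed.

(** A variable other than [j] on which no chosen term depends would make the sum cancel. So the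
    chosen terms, of at most one or two variables each, must cover everything but [j]. *)
Lemma choice_parity_size S j phi :
  choice_parity S j phi -> n <= (\sum_(i in S) (phi i).+1).+1.
Proof.
move=> /choice_parity_cover cov.
have sub : [set: 'I_n] \subset j |: \bigcup_(i in S) dep i (phi i).
  apply/subsetP => u _; rewrite in_setU1; case: eqVneq => //= /cov[i iS ui].
  by apply/bigcupP; exists i.
rewrite -[X in X <= _](card_ord n) -cardsT (leq_trans (subset_leq_card sub)) //.
rewrite cardsU1 -add1n leq_add ?leq_b1 //.
elim/big_rec2: _ => [|i y A _ le_Ay]; first by rewrite cards0.
by rewrite (leq_trans (leq_card_setU _ _)) // leq_add // card_dep.
Qed.

Lemma solution_parity_small S j : (#|S|.*2).+1 < n -> solution_parity S j = false.
Proof.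
move=> ltSn; rewrite solution_parityE big1 // => phi _; apply: contraTF ltSn.
move=> /choice_parity_size le_n; rewrite -leqNgt (leq_trans le_n) // ltnS.
by rewrite -muln2 -sum_nat_const leq_sum // => i _; case: (phi i).
Qed.

(** * Systems whose product terms form a near-perfect matching *)

Section NearMatching.

Variables (M : {set 'I_n}) (e q : 'I_n).
Hypotheses (p_inj : injective p) (v_inj : injective v).
Hypothesis wE : forall i, w i = v (v i).
(* The edges [{v i, v (v i)}], [i] in [M], partition the complement of [{q, p e}]:
   every vertex is [v (v i)] for exactly one [i]. *)
Hypothesis matching :
  forall i, (i \in M) + (v i \in M) + (w i == q) + (w i == p e) = 1.
Hypotheses (eM : e \notin M) (pe_v : p e != v e) (pe_w : p e != w e).

Lemma w_inj : injective w.
Proof. by move=> i j; rewrite !wE => /v_inj/v_inj. Qed.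

(** Sum [matching] over all [i]: [v] and [w] are permutations, so the four summands total #|M|,
    #|M|, 1 and 1. *)
Lemma card_near_matching : #|M|.*2.+2 = n.
Proof.
have : \sum_i ((i \in M) + (v i \in M) + (w i == q) + (w i == p e)) = n.
  by under eq_bigr do rewrite matching; rewrite sum_nat_const muln1 card_ord.
rewrite !big_split /=.
have sum_in : \sum_i (i \in M : nat) = #|M|.
  by rewrite -sum1_card [RHS]big_mkcond; apply: eq_bigr => i _; case: (_ \in _).
have sum_eq z : \sum_i ((w i == z) : nat) = 1.
  have <- : \sum_i ((i == z) : nat) = 1.
    by rewrite (bigD1 z) //= eqxx big1 ?addn0 // => i /negPf->.
  by rewrite [RHS](reindex_inj w_inj).
have -> : \sum_i (v i \in M : nat) = #|M| by rewrite -sum_in [RHS](reindex_inj v_inj).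
by rewrite sum_in !sum_eq !addn1 addnn.
Qed.

Lemma near_matching_e_linear j phi :
  j != p e -> choice_parity (e |: M) j phi -> phi e = false.
Proof.
move=> jpe /choice_parity_cover/(_ (p e)); rewrite eq_sym => /(_ jpe)[i].
have notin i' : i' \in M -> (p e != v i') && (p e != w i').
  (* The first endpoint [v i'] is [w i0] for the predecessor [i0] of [i'], so [matching i0] governs
     it; [matching i'] governs the second endpoint. *)
  have [i0 _ i0E] : exists2 i0, true & i' = v i0.
    by exists (invF v_inj i'); rewrite ?f_invF.
  move=> i'M; have := matching i0; have := matching i'.
  rewrite (wE i0) -i0E i'M !(eq_sym (p e)).
  by do 2![case: (_ == p e)]; lia.
rewrite in_setU1 => /orP[/eqP->|iM].
  by rewrite /dep; case: (phi e) => //; rewrite !inE (negPf pe_v) (negPf pe_w).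
rewrite /dep; case: (phi i); rewrite !inE.
  by have /andP[/negPf-> /negPf->] := notin i iM.
by move=> /eqP/p_inj ei; move: eM; rewrite ei iM.
Qed.

(** With [e] contributing one variable, covering [n] = 2 #|M| + 2 vertices, [j] included, leaves no
    slack: every [i] in [M] must contribute two. *)
Lemma near_matching_choice j phi :
  j != p e -> phi \in pffun_on false (mem (e |: M)) predT ->
  choice_parity (e |: M) j phi -> phi = [ffun i => i \in M].
Proof.
move=> jpe /pffun_onP[/supportP phi0 _] chi.
have phie := near_matching_e_linear jpe chi.
have := choice_parity_size chi; rewrite big_setU1 //= phie.
under eq_bigr => i _ do rewrite -add1n.
have sumM : \sum_(i in M) 1 = #|M| by rewrite sum1_card.
rewrite big_split /= sumM -{1}card_near_matching => size_phi.
have sumC : \sum_(i in M) (phi i : nat) + \sum_(i in M) (~~ phi i : nat) = #|M|.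
  by rewrite -big_split -sumM; apply: eq_bigr => i _; case: (phi i).
move: size_phi; rewrite add1n !ltnS -addnn leq_add2l -{1}sumC.
rewrite -[X in _ <= X]addn0 leq_add2l leqn0 sum_nat_eq0 => /forall_inP phiM.
apply/ffunP => i; rewrite ffunE; case: (boolP (i \in M)) => [/phiM|iM].
  by case: (phi i).
case: (eqVneq i e) => [->//|ie]; apply: phi0.
by rewrite in_setU1 negb_or ie iM.
Qed.

(** Only one choice survives. Its terms miss [q], which gives 0 for [j != q]; for [j = q] they fix
    every other coordinate, so a single point counts. *)
Lemma near_matching_parity j :
  j != p e -> solution_parity (e |: M) j = (j == q).
Proof.
move=> jpe; rewrite solution_parityE.
set phi := [ffun i => i \in M].
have phi_fam : phi \in pffun_on false (mem (e |: M)) predT.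
  apply/pffun_onP; split=> //; apply/supportP => i; rewrite in_setU1 negb_or ffunE.
  by case/andP => _ /negPf.
rewrite (bigD1 phi) //= big1 ?addbF; last first.
  move=> psi /andP[fam ne]; apply: contraNF ne => chi.
  by apply/eqP; apply: near_matching_choice chi.
have vM i : v i \in M -> i \in M = false.
  by move=> viM; have := matching i; rewrite viM; case: (i \in M); lia.
have qpe : q != p e.
  have [i wi] : exists i, w i = p e by exists (invF w_inj (p e)); rewrite f_invF.
  by apply/eqP => qpe; have := matching i; rewrite wi qpe eqxx; lia.
have vq i : i \in M -> (v i == q = false) * (v i == p e = false).
  set i0 := invF v_inj i; have i0E : i = v i0 by rewrite f_invF.
  move=> iM; have := matching i0; rewrite wE -i0E iM.
  by case: (_ == q); case: (_ == p e) => // H; exfalso; lia.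
have wM i : i \in M -> (w i == q = false) * (w i == p e = false).
  by move=> iM; have := matching i; rewrite iM;
    case: (_ == q); case: (_ == p e) => // H; exfalso; lia.
case: (eqVneq j q) => [->|jq]; last first.
  apply: (@choice_parity_uncovered _ _ _ q); rewrite 1?eq_sym // => i.
  rewrite in_setU1 ffunE /dep => /orP[/eqP->|iM].
    by rewrite (negPf eM) inE.
  by rewrite iM !inE !(eq_sym q) vq // wM.
(* The unique point at which every chosen term is true. *)
pose xs : vec n := [ffun u =>
  if u == q then true else if u == p e then ~~ sp e
  else let i := invF w_inj u in (i \in M) && ~~ sw i].
rewrite /choice_parity (bigD1 xs) //= [X in _ (+) X]big1 ?addbF => [|x].
  rewrite ffunE eqxx big_andE; apply/forall_inP => i; rewrite in_setU1 ffunE.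
  move=> /orP[/eqP->|iM].
    rewrite (negPf eM) /term ffunE eq_sym (negPf qpe) eqxx.
    by case: (sp e).
  rewrite iM /term !ffunE !vq // !wM //= invF_f iM /=.
  set i0 := invF v_inj i; have i0E : i = v i0 by rewrite f_invF.
  have -> : invF w_inj (v i) = i0 by rewrite {1}i0E -wE invF_f.
  by rewrite vM -?i0E //=; case: (sw i).
move=> xxs; apply: contraNF xxs => /andP[xq].
rewrite big_andE => /forall_inP xterm.
apply/eqP/ffunP => u; rewrite ffunE; case: eqVneq => [->//|uq].
case: eqVneq => [->|upe].
  move: (xterm e); rewrite setU11 ffunE (negPf eM) /term => /(_ isT).
  by case: (x _); case: (sp e).
(* The vertex [u] is the second endpoint of edge [i] and the first of edge [v i]; exactly one of
   these edges is in [M], and its factor determines [x u]. *)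
set i := invF w_inj u; have uE : u = w i by rewrite f_invF.
have := matching i; rewrite -uE (negPf uq) (negPf upe) !addn0.
case: (boolP (i \in M)) => iM /=.
  move: (xterm i); rewrite in_setU1 iM orbT ffunE iM /term -uE => /(_ isT).
  by case/andP => _; case: (x u); case: (sw i).
case: (boolP (v i \in M)) => // viM _.
move: (xterm (v i)); rewrite in_setU1 viM orbT ffunE viM /term -wE -uE => /(_ isT).
by case/andP => /negPf->; rewrite (negPf iM).
Qed.

End NearMatching.

End QuadraticSystem.

(** * The two odd cycles and their near-perfect matchings *)

Lemma coord_ord n (x : vec n) (i : 'I_n) : coord x i = x i.
Proof. by rewrite /coord valK. Qed.

(* Successor on the two cycles [0, k-2] and [k-1, 2k-1]. *)
Definition succ_idx (k i : nat) : nat :=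
  if i == k - 2 then 0 else if i == 2 * k - 1 then k - 1 else i.+1.

(* Index of the linear term of the [i]-th coordinate. *)
Definition lin_idx (k i : nat) : nat :=
  if i == k - 3 then k else if i == k - 2 then k - 1
  else if i == k - 1 then k - 3 else if i == k then k - 2 else i.

(** The default [i] of [insubd] is never reached when [4 <= k]: the index maps stay below
    [2 * k]. *)
Definition succ_ord k (i : 'I_(2 * k)) : 'I_(2 * k) := insubd i (succ_idx k i).
Definition succ2_ord k (i : 'I_(2 * k)) : 'I_(2 * k) := succ_ord (succ_ord i).
Definition lin_ord k (i : 'I_(2 * k)) : 'I_(2 * k) := insubd i (lin_idx k i).

(* [mate l n i]: on an odd cycle of length [n], the edge [{i+1, i+2}] belongs to
   the perfect matching of the complement of the vertex [l]. *)
Definition mate (l n i : nat) : bool :=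
  [&& l <= i, odd i == odd l & i != l + n - 1]
  || [&& i < l, odd i != odd l & i.+1 != l].

Definition in_mates (k l m i : nat) : bool :=
  ((i < k - 1) && mate l (k - 1) i) || ((k - 1 <= i) && mate m (k + 1) i).

Definition mates (k l m : nat) : {set 'I_(2 * k)} :=
  [set i : 'I_(2 * k) | in_mates k l m i].

Lemma succ_idxP k i : 4 <= k -> i < 2 * k ->
  [\/ i = k - 2 /\ succ_idx k i = 0,
      i = 2 * k - 1 /\ succ_idx k i = k - 1 |
      [/\ i != k - 2, i != 2 * k - 1 & succ_idx k i = i.+1]].
Proof.
move=> hk ltik; rewrite /succ_idx; case: eqVneq => [->|ne1]; first by constructor 1.
by case: eqVneq => [->|ne2]; [constructor 2 | constructor 3].
Qed.

Lemma in_mates_low k l m i : i < k - 1 -> in_mates k l m i = mate l (k - 1) i.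
Proof. by move=> lti; rewrite /in_mates lti [k - 1 <= i]leqNgt lti orbF. Qed.

Lemma in_mates_high k l m i : k - 1 <= i -> in_mates k l m i = mate m (k + 1) i.
Proof. by move=> lei; rewrite /in_mates ltnNge lei. Qed.

(** Chosen edges alternate around the cycle, except that both edges through [l] are left out. Here
    nothing wraps around; [mate_wrap] and [mate_wrap1] treat [i.+2] and [i.+1] wrapping to the first
    vertex [o], where odd length makes the pattern close up. *)
Lemma mate_step l n i : i < l + n - 2 -> l < i + n ->
  mate l n i + mate l n i.+1 + (i.+2 == l) = 1.
Proof.
move=> lt1 lt2; rewrite /mate /=.
have [lt|[gt|eq]] : l <= i \/ i.+1 < l \/ l = i.+1 by lia.
- have [-> -> -> ->] : [/\ l <= i.+1, (i < l) = false, (i.+1 < l) = false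
    & (i.+2 == l) = false] by split; lia.
  have [-> ->] : i != l + n - 1 /\ i.+1 != l + n - 1 by lia.
  by rewrite lt; case: (odd i); case: (odd l).
- have [-> -> -> ->] : [/\ (l <= i) = false, (l <= i.+1) = false, i < l
    & i.+1 != l] by split; lia.
  rewrite gt; case: (eqVneq i.+2 l) => [<-|ne] /=; first by case: (odd i).
  by case: (odd i); case: (odd l).
- by rewrite eq; lia.
Qed.

Lemma mate_wrap o l n : odd n -> 2 < n -> o <= l < o + n ->
  mate l n (o + n - 2) + mate l n (o + n - 1) + (o == l) = 1.
Proof.
move=> on n2 /andP[lo ln]; rewrite /mate.
have -> : odd (o + n - 2) = ~~ odd o by rewrite oddB ?oddD ?on; [case: (odd o) | lia].
have -> : odd (o + n - 1) = odd o by rewrite oddB ?oddD ?on; [case: (odd o) | lia].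
have -> : l <= o + n - 1 by lia.
have -> : (o + n - 1 < l) = false by lia.
have [eq|ne] := eqVneq o l.
  have -> : (o + n - 2 < l) = false by lia.
  by rewrite eq !eqxx /=; case: (odd l); rewrite ?andbF.
have [eq|ne'] := eqVneq l (o + n - 1).
  have [-> -> ->] : [/\ (l <= o + n - 2) = false, (o + n - 2).+1 != l = false
    & o + n - 1 != l + n - 1] by split; lia.
  by rewrite !andbF /= eq oddB ?oddD ?on; [case: (odd o) | lia].
have [-> -> -> ->] : [/\ l <= o + n - 2, (o + n - 2 < l) = false,
  o + n - 2 != l + n - 1 & o + n - 1 != l + n - 1] by split; lia.
by case: (odd o); case: (odd l).
Qed.

Lemma mate_wrap1 o l n : odd n -> 2 < n -> o <= l < o + n ->
  mate l n (o + n - 1) + mate l n o + (o.+1 == l) = 1.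
Proof.
move=> on n2 /andP[lo ln]; rewrite /mate.
have -> : odd (o + n - 1) = odd o by rewrite oddB ?oddD ?on; [case: (odd o) | lia].
have -> : l <= o + n - 1 by lia.
have -> : (o + n - 1 < l) = false by lia.
have [<-|ne] := eqVneq o l.
  have [-> -> ->] : [/\ o != o + n - 1, o < o = false & o.+1 == o = false].
    by split; lia.
  by rewrite !eqxx leqnn.
have [-> -> ->] : [/\ l <= o = false, o < l & o + n - 1 != l + n - 1].
  by split; lia.
have [<-|ne'] /= := eqVneq o.+1 l; first by case: (odd o).
by case: (odd o); case: (odd l).
Qed.

Lemma in_mates_matching k l m i : 4 <= k -> ~~ odd k ->
  l < k - 1 -> k - 1 <= m < 2 * k -> i < 2 * k ->
  in_mates k l m i + in_mates k l m (succ_idx k i)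
  + (succ_idx k (succ_idx k i) == l) + (succ_idx k (succ_idx k i) == m) = 1.
Proof.
move=> hk ek ltl mk lti.
have [oA oB] : odd (k - 1) /\ odd (k + 1) by split; lia.
have lA : 0 <= l < 0 + (k - 1) by lia.
have mB : k - 1 <= m < (k - 1) + (k + 1) by lia.
have k2 : 2 < k - 1 by lia.
have k2' : 2 < k + 1 by lia.
case: (succ_idxP hk lti) => [[-> ->]|[-> ->]|[n1 n2 ->]].
- have -> : succ_idx k 0 = 1 by rewrite /succ_idx; do 2?case: eqP; lia.
  have -> : (1 == m) = false by lia.
  rewrite !in_mates_low; try lia.
  by rewrite addn0 -[RHS](mate_wrap1 oA k2 lA); congr (mate _ _ _ + _ + _); lia.
- have -> : succ_idx k (k - 1) = k by rewrite /succ_idx; do 2?case: eqP; lia.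
  have -> : (k == l) = false by lia.
  rewrite !in_mates_high; try lia.
  rewrite addn0 -[RHS](mate_wrap1 oB k2' mB); congr (mate _ _ _ + _ + (_ == m)); lia.
have lti1 : i.+1 < 2 * k by lia.
case: (succ_idxP hk lti1) => [[ie ->]|[ie ->]|[m1 m2 ->]].
- have -> : (0 == m) = false by lia.
  rewrite !in_mates_low; try lia.
  by rewrite addn0 -[RHS](mate_wrap oA k2 lA); congr (mate _ _ _ + mate _ _ _ + _); lia.
- have -> : (k - 1 == l) = false by lia.
  rewrite !in_mates_high; try lia.
  by rewrite addn0 -[RHS](mate_wrap oB k2' mB); congr (mate _ _ _ + mate _ _ _ + _); lia.
case: (ltnP i (k - 1)) => ik.
  have -> : (i.+2 == m) = false by lia.
  by rewrite !in_mates_low ?addn0 ?mate_step //; lia.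
have -> : (i.+2 == l) = false by lia.
by rewrite !in_mates_high ?addn0 ?mate_step //; lia.
Qed.

Lemma ltn_succ_idx k i : 4 <= k -> i < 2 * k -> succ_idx k i < 2 * k.
Proof.
by move=> hk lti; case: (succ_idxP hk lti) => [[_ ->]|[_ ->]|[_ ? ->]]; lia.
Qed.

(** This and [succ_idx_zero] locate the two edges through the first vertex of each cycle. *)
Lemma succ_idx_base k i : 4 <= k -> i < 2 * k ->
  succ_idx k i = k - 1 \/ succ_idx k (succ_idx k i) = k - 1 ->
  i = 2 * k - 1 \/ i = 2 * k - 2.
Proof.
move=> hk lti; have lts := ltn_succ_idx hk lti.
by case: (succ_idxP hk lti) => [[? ?]|[? ?]|[? ? ?]];
  case: (succ_idxP hk lts) => [[? ?]|[? ?]|[? ? ?]]; lia.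
Qed.

Lemma succ_idx_zero k i : 4 <= k -> i < 2 * k ->
  succ_idx k i = 0 \/ succ_idx k (succ_idx k i) = 0 ->
  i = k - 2 \/ i = k - 3.
Proof.
move=> hk lti; have lts := ltn_succ_idx hk lti.
by case: (succ_idxP hk lti) => [[? ?]|[? ?]|[? ? ?]];
  case: (succ_idxP hk lts) => [[? ?]|[? ?]|[? ? ?]]; lia.
Qed.

(** * The ANF of the inverse as solution parities of a quadratic system *)

Section Chichi.

Variables (k : nat) (hk : 4 <= k).

Local Notation V := 'I_(2 * k).
(** The constant of 1 + G_i goes into the linear term. Row [k - 1] is the exception: its linear term
    is already complemented, and so is its second factor. *)
Local Notation sp := (fun i : V => val i != k - 1).
Local Notation sw := (fun i : V => val i == k - 1).
Local Notation chi_term :=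
  (term (@lin_ord k) (@succ_ord k) (@succ2_ord k) sp sw).
Local Notation parity :=
  (solution_parity (@lin_ord k) (@succ_ord k) (@succ2_ord k) sp sw).

Lemma val_succ_ord (i : V) : succ_ord i = succ_idx k i :> nat.
Proof.
by rewrite val_insubd ltn_succ_idx.
Qed.

Lemma val_succ2_ord (i : V) : succ2_ord i = succ_idx k (succ_idx k i) :> nat.
Proof. by rewrite /succ2_ord !val_succ_ord. Qed.

Lemma val_lin_ord (i : V) : lin_ord i = lin_idx k i :> nat.
Proof.
rewrite val_insubd; case: ifP => // /negP[]; rewrite /lin_idx.
by have := ltn_ord i; do !case: eqP => _; lia.
Qed.

Lemma succ_ord_inj : injective (@succ_ord k).
Proof.
move=> i j /(congr1 (@nat_of_ord _)); rewrite !val_succ_ord => eq_ij; apply: val_inj => /=.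
move: eq_ij; have := ltn_ord i; have := ltn_ord j; rewrite /succ_idx.
by do !case: eqP => ?; lia.
Qed.

Lemma lin_ord_inj : injective (@lin_ord k).
Proof.
move=> i j /(congr1 (@nat_of_ord _)); rewrite !val_lin_ord => eq_ij; apply: val_inj => /=.
move: eq_ij; rewrite /lin_idx.
by do !case: eqP => ?; lia.
Qed.

Lemma CHICHI_term (x : vec (2 * k)) (i : V) :
  ~~ CHICHI x i = chi_term i true x (+) chi_term i false x.
Proof.
rewrite /term -!coord_ord val_lin_ord val_succ2_ord val_succ_ord coord_ord ffunE.
set X := coord x; have := ltn_ord i; rewrite /lin_idx /=.
move: (nat_of_ord i) => {}i lti.
have sE j : j != k - 2 -> j != 2 * k - 1 -> succ_idx k j = j.+1.
  by rewrite /succ_idx => /negPf-> /negPf->.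
have s1 : succ_idx k (k - 2) = 0 by rewrite /succ_idx eqxx.
have s2 : succ_idx k (2 * k - 1) = k - 1.
  by rewrite /succ_idx eqxx; case: eqP => //; lia.
have e3 : succ_idx k (k - 3) = k - 2 by rewrite sE; lia.
have e0 : succ_idx k 0 = 1 by rewrite sE; lia.
have e1 : succ_idx k (k - 1) = k by rewrite sE; lia.
have ek : succ_idx k k = k + 1 by rewrite sE; lia.
have ek1 : succ_idx k (k + 1) = k + 2 by rewrite sE; lia.
have e2k : succ_idx k (2 * k - 2) = 2 * k - 1 by rewrite sE; lia.
case: eqVneq => [->|n3].
  have -> : (k - 3 == k - 1) = false by lia.
  by rewrite e3 s1; case: (X k); case: (X (k - 2)); case: (X 0).
case: eqVneq => [->|n2].
  have -> : (k - 2 == k - 1) = false by lia.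
  by rewrite s1 e0; case: (X (k - 1)); case: (X 0); case: (X 1).
case: eqVneq => [->|n1].
  by rewrite e1 ek; case: (X (k - 3)); case: (X k); case: (X (k + 1)).
case: eqVneq => [->|n0].
  by rewrite ek ek1; case: (X (k - 2)); case: (X (k + 1)); case: (X (k + 2)).
case: eqVneq => [->|n4].
  by rewrite e2k s2; case: (X (2 * k - 2)); case: (X (2 * k - 1)); case: (X (k - 1)).
case: eqVneq => [->|n5].
  by rewrite s2 e1; case: (X (2 * k - 1)); case: (X (k - 1)); case: (X k).
have -> : succ_idx k i = i.+1 by rewrite sE.
have -> : succ_idx k i.+1 = i.+2 by rewrite sE; lia.
by case: (X i); case: (X i.+1); case: (X i.+2).
Qed.

Variables (Ginv : vec (2 * k) -> vec (2 * k)) (hinv : cancel (@CHICHI k) Ginv).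
Variable b : vec (2 * k).

(** Substituting y = [CHICHI x] turns the range of the Moebius sum into the equations
    [CHICHI x i = false] for [i] outside [u]. *)
Lemma anf_coef_inverse (u : vec (2 * k)) :
  anf_coef (fun y => dot b (Ginv y)) u =
  \big[addb/false]_(j : V) (b j && parity [set i | ~~ u i] j).
Proof.
rewrite /anf_coef big_xorb.
have bijG : bijective (@CHICHI k) by apply: injF_bij; apply: can_inj hinv.
rewrite (reindex (@CHICHI k)) /=; last exact: onW_bij.
under eq_bigr => x _ do rewrite hinv /dot big_xorb.
rewrite big_mkcond /=.
under [RHS]eq_bigr => j _ do rewrite /solution_parity big_distrr /=.
rewrite [RHS]exchange_big /=; apply: eq_bigr => x _.
under [RHS]eq_bigr => j _ do rewrite andbA.
rewrite -big_distrl /= andbC big_andE.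
have -> : [forall i, CHICHI x i ==> u i] =
  [forall (i | i \in [set i | ~~ u i]), chi_term i true x (+) chi_term i false x].
  apply: eq_forallb => i; rewrite -CHICHI_term inE.
  by case: (u i); case: (CHICHI x i).
by case: [forall (i | _), _].
Qed.

(** * Vanishing weight-[k] coefficients force [b] to be zero *)

Hypothesis hev : ~~ odd k.
Hypothesis low : forall u : vec (2 * k), #|[set i | u i]| = k ->
  anf_coef (fun y => dot b (Ginv y)) u = false.

Lemma low_parity (S : {set V}) :
  #|S| = k -> \big[addb/false]_(j : V) (b j && parity S j) = false.
Proof.
move=> cardS; have := anf_coef_inverse [ffun i => i \notin S].
have -> : [set i | ~~ [ffun i => i \notin S] i] = S.
  by apply/setP => i; rewrite inE ffunE negbK.
move=> <-; apply: low.
have -> : [set i | [ffun i => i \notin S] i] = ~: S.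
  by apply/setP => i; rewrite !inE ffunE.
by rewrite cardsCs setCK card_ord cardS; lia.
Qed.

(** The vertices [q] and [lin_ord e] are the two unmatched ones, in either order. The last
    hypothesis removes the contribution of [lin_ord e] to the coefficient, leaving [b q] alone. *)
Lemma near_matching_vanish (l m : nat) (e q : V) :
  l < k - 1 -> k - 1 <= m < 2 * k ->
  (val q = l /\ lin_idx k e = m) \/ (val q = m /\ lin_idx k e = l) ->
  ~~ in_mates k l m e ->
  lin_idx k e != succ_idx k e -> lin_idx k e != succ_idx k (succ_idx k e) ->
  (b (lin_ord e) ==> ~~ parity (e |: mates k l m) (lin_ord e)) -> b q = false.
Proof.
move=> ltl mk qe eM ne1 ne2 bpe.
have matching i : (i \in mates k l m) + (succ_ord i \in mates k l m)
    + (succ2_ord i == q) + (succ2_ord i == lin_ord e) = 1.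
  rewrite -[RHS](in_mates_matching hk hev ltl mk (ltn_ord i)) !inE.
  rewrite -!val_eqE /= val_succ2_ord val_succ_ord val_lin_ord.
  by case: qe => [[-> ->]|[-> ->]] //; rewrite addnAC.
have succ2E (i : V) : succ2_ord i = succ_ord (succ_ord i) by [].
have eM' : e \notin mates k l m by rewrite inE.
have pe_v : lin_ord e != succ_ord e by rewrite -val_eqE /= val_lin_ord val_succ_ord.
have pe_w : lin_ord e != succ2_ord e.
  by rewrite -val_eqE /= val_lin_ord val_succ2_ord.
have cardS : #|e |: mates k l m| = k.
  have half c : c.*2.+2 = 2 * k -> c.+1 = k by lia.
  rewrite cardsU1 eM' add1n; apply: half.
  exact: card_near_matching succ_ord_inj succ2E matching.
have par j : j != lin_ord e -> parity (e |: mates k l m) j = (j == q).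
  exact: near_matching_parity lin_ord_inj succ_ord_inj succ2E matching eM' pe_v pe_w j.
have qpe : q != lin_ord e.
  by rewrite -val_eqE /= val_lin_ord; case: qe => [[-> ->]|[-> ->]]; lia.
move: (low_parity cardS); rewrite (bigD1 q) //= par // eqxx andbT big1 ?addbF //.
move=> j jq; have [->|jpe] := eqVneq j (lin_ord e).
  by move: bpe; case: (b _) => //= /negPf->.
by rewrite par // (negPf jq) andbF.
Qed.

Lemma coord_vanish (l m e q : nat) :
  l < k - 1 -> k - 1 <= m < 2 * k -> e < 2 * k ->
  (q = l /\ lin_idx k e = m) \/ (q = m /\ lin_idx k e = l) ->
  ~~ in_mates k l m e ->
  lin_idx k e != succ_idx k e -> lin_idx k e != succ_idx k (succ_idx k e) ->
  coord b (lin_idx k e) = false -> coord b q = false.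
Proof.
move=> ltl mk lte qe eM ne1 ne2.
have ltq : q < 2 * k by lia.
rewrite -[e]/(val (Ordinal lte)) -val_lin_ord coord_ord => be.
rewrite -[q]/(val (Ordinal ltq)) coord_ord.
by apply: (@near_matching_vanish l m (Ordinal lte)) => //; rewrite be.
Qed.

(* Covering vertex [k - 1] forces the linear term of index [k - 2], and then vertex
   [0] cannot be covered. *)
Lemma parity_block_link (e : V) : val e = k ->
  parity (e |: mates k (k - 2) (k - 1)) (lin_ord e) = false.
Proof.
move=> eE; rewrite solution_parityE big1 // => phi _; apply: contraTF isT => chi.
have lt0 : 0 < 2 * k by lia.
have lt1 : k - 1 < 2 * k by lia.
have lt2 : k - 2 < 2 * k by lia.
have lin_e : lin_idx k e = k - 2 by rewrite [nat_of_ord e]eE /lin_idx; do !case: eqP; lia.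
have cov := choice_parity_cover chi.
have inS i : i \in e |: mates k (k - 2) (k - 1) ->
    i = k :> nat \/ in_mates k (k - 2) (k - 1) i.
  by rewrite in_setU1 inE => /orP[/eqP->|]; [left | right].
have phi2 : phi (Ordinal lt2) = false.
  have [|i /inS iS] := cov (Ordinal lt1).
    by rewrite -val_eqE /= val_lin_ord lin_e; lia.
  rewrite /dep; case phi_i: (phi i); rewrite !inE -!val_eqE /=.
    rewrite val_succ2_ord val_succ_ord => Hi; exfalso.
    have Hi' : i = 2 * k - 1 :> nat \/ i = 2 * k - 2 :> nat.
      by apply: succ_idx_base => //; move/orP: Hi => [] /eqP <-; [left | right].
    by case: iS; rewrite ?in_mates_high /mate; lia.
  rewrite val_lin_ord => Hi; rewrite -phi_i; congr (phi _); apply: val_inj => /=.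
  by move/eqP: Hi; rewrite /lin_idx; do !case: eqP => ?; lia.
have [|i /inS iS] := cov (Ordinal lt0).
  by rewrite -val_eqE /= val_lin_ord lin_e; lia.
rewrite /dep; case phi_i: (phi i); rewrite !inE -!val_eqE /=.
  rewrite val_succ2_ord val_succ_ord => Hi; exfalso.
  (* Row [k - 2] already spends its linear term on vertex [k - 1], and row [k - 3] is outside the
     matching. *)
  have [Hi'|Hi'] : i = k - 2 :> nat \/ i = k - 3 :> nat.
    by apply: succ_idx_zero => //; move/orP: Hi => [] /eqP <-; [left | right].
    by move: phi_i; rewrite (_ : i = Ordinal lt2) ?phi2 //; apply: val_inj.
  by case: iS; rewrite ?in_mates_low /mate; lia.
rewrite val_lin_ord => Hi; exfalso.
have Hi' : i = 0 :> nat.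
  by move/eqP: Hi; rewrite /lin_idx; do !case: eqP => ?; lia.
by case: iS; rewrite ?in_mates_low /mate; lia.
Qed.

(** The four rows whose linear term crosses between the cycles serve as [e]: first [k], with no
    prior knowledge, then [k - 2], [k - 1], [k - 3] and [k] again. Each round uses a vertex settled
    before as [lin_idx k e], and the parity condition on [q] keeps [e] out of the matching. *)
Lemma low_degree_eq0 : b = [ffun => false].
Proof.
have [l3 l2 l1 l0] : [/\ lin_idx k (k - 3) = k, lin_idx k (k - 2) = k - 1,
    lin_idx k (k - 1) = k - 3 & lin_idx k k = k - 2].
  by rewrite /lin_idx; split; do !case: eqP => ?; lia.
have [s3 s2 s1 s0] : [/\ succ_idx k (k - 3) = k - 2, succ_idx k (k - 2) = 0,
    succ_idx k (k - 1) = k & succ_idx k k = k.+1].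
  by rewrite /succ_idx; split; do !case: eqP => ?; lia.
have [t2 t0] : succ_idx k 0 = 1 /\ succ_idx k k.+1 = k.+2.
  by rewrite /succ_idx; split; do !case: eqP => ?; lia.
have b_k1 : coord b (k - 1) = false.
  have ltk : k < 2 * k by lia.
  have ltk1 : k - 1 < 2 * k by lia.
  rewrite -[k - 1]/(val (Ordinal ltk1)) coord_ord.
  apply: (@near_matching_vanish (k - 2) (k - 1) (Ordinal ltk)) => /=;
    rewrite ?l0 ?s0 ?t0 ?parity_block_link ?implybT //; try lia.
  by rewrite in_mates_high /mate; lia.
have b_odd l : l < k - 1 -> odd l -> coord b l = false.
  move=> ltl ol; apply: (@coord_vanish l (k - 1) (k - 2));
    rewrite ?l2 ?s2 ?t2 //; try lia.
  by rewrite in_mates_low /mate; lia.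
(* The vertex [k - 3] is odd, hence settled by [b_odd]. The case [m = k] is included because the
   next round needs vertex [k]. *)
have b_hi1 m : k - 1 < m < 2 * k -> odd m || (m == k) -> coord b m = false.
  move=> mk om; apply: (@coord_vanish (k - 3) m (k - 1));
    rewrite ?l1 ?s1 ?s0 ?b_odd //; try lia.
  by rewrite in_mates_high /mate; lia.
have b_even l : l < k - 1 -> ~~ odd l -> coord b l = false.
  move=> ltl ol; apply: (@coord_vanish l k (k - 3));
    rewrite ?l3 ?s3 ?s2 ?b_hi1 ?eqxx ?orbT //; try lia.
  by rewrite in_mates_low /mate; lia.
have b_hi0 m : k < m < 2 * k -> ~~ odd m -> coord b m = false.
  move=> mk om; apply: (@coord_vanish (k - 2) m k);
    rewrite ?l0 ?s0 ?t0 ?b_even //; try lia.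
  by rewrite in_mates_high /mate; lia.
apply/ffunP => i; rewrite ffunE -coord_ord; have := ltn_ord i.
move: (nat_of_ord i) => j ltj.
case: (ltnP j (k - 1)) => [ltjk|].
  by case: (boolP (odd j)) => oj; [apply: b_odd | apply: b_even].
rewrite leq_eqVlt => /orP[/eqP<-//|gtj].
case: (boolP (odd j || (j == k))) => [oj|]; first by apply: b_hi1; rewrite ?gtj.
by rewrite negb_or => /andP[oj nj]; apply: b_hi0; lia.
Qed.

End Chichi.

(** * The degree is at most [k] and at least [k] *)

Theorem theorem6 (k : nat) (hk : 4 <= k) (hev : ~~ odd k)
  (Ginv : vec (2 * k) -> vec (2 * k)) (hinv : cancel (@CHICHI k) Ginv)
  (b : vec (2 * k)) (hb : b != [ffun => false]) :
  alg_degree (fun x => dot b (Ginv x)) = k.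
Proof.
apply/eqP; rewrite eqn_leq; apply/andP; split.
  apply/bigmax_leqP => u; apply: contraLR; rewrite -ltnNge => ltk.
  rewrite (anf_coef_inverse hk hinv) big1 // => j _.
  rewrite solution_parity_small ?andbF //.
  have -> : [set i | ~~ u i] = ~: [set i | u i] by apply/setP => i; rewrite !inE.
  have small c : k < c -> (2 * k - c).*2.+1 < 2 * k by lia.
  by rewrite cardsCs setCK card_ord; apply: small.
rewrite leqNgt; apply: contraNN hb => lt_deg; apply/eqP.
apply: (low_degree_eq0 hk hinv hev) => u cardu; apply: contraTF lt_deg => cu.
by rewrite -leqNgt -{1}cardu; apply: leq_bigmax_cond.
Qed.
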